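(* Let $H_1$ and $H_2$ be real Hilbert spaces, let $f:H_1\rightarrow H_1$ and $g:H_2\rightarrow H_2$ be operators, let $A:H_1\rightarrow H_2$ be a bounded linear operator, and let $C\subseteq H_1$ and $Q\subseteq H_2$ be nonempty, closed and convex subsets. Let $\boldsymbol{H}=H_1\times H_2$, $\boldsymbol{D}:=C\times Q$, $\boldsymbol{V}:=\{(x,y)\in\boldsymbol{H}\mid Ax=y\}$, and define $\boldsymbol{h}:\boldsymbol{H}\rightarrow\boldsymbol{H}$ by $\boldsymbol{h}(x,y)=(f(x),g(y))$. Then a point $\boldsymbol{x}^{\ast}=(x^{\ast},y^{\ast})\in\boldsymbol{H}$ satisfies $$\boldsymbol{x}^{\ast}\in\boldsymbol{D}\cap\boldsymbol{V}\quad\text{and}\quad\langle\boldsymbol{h}(\boldsymbol{x}^{\ast}),\boldsymbol{x}-\boldsymbol{x}^{\ast}\rangle\geq 0\ \text{ for all }\boldsymbol{x}=(x,y)\in\boldsymbol{D}$$ if and only if $x^{\ast}$ and $y^{\ast}$ solve the Split Variational Inequality Problem, that is, $x^{\ast}\in C$ and $\langle f(x^{\ast}),x-x^{\ast}\rangle\geq 0$ for all $x\in C$, and $y^{\ast}=Ax^{\ast}\in Q$ and $\langle g(y^{\ast}),y-y^{\ast}\rangle\geq 0$ for all $y\in Q$.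
   Context: The product space $\boldsymbol{H}=H_1\times H_2$ carries the usual Hilbert product structure, $\langle(x,y),(x',y')\rangle=\langle x,x'\rangle+\langle y,y'\rangle$. *)

(* Defs.v *)
From HB Require Import structures.
From mathcomp Require Import all_boot all_order all_algebra sesquilinear.
From mathcomp Require Import all_classical all_reals all_analysis.
From mathcomp Require Import ring lra.

Set Implicit Arguments.
Unset Strict Implicit.
Unset Printing Implicit Defensive.

Import Order.TTheory GRing.Theory Num.Theory.
Import numFieldNormedType.Exports.

Local Open Scope classical_set_scope.
Local Open Scope ring_scope.

HB.mixin Record CompleteNormedModule_isHilbert (R : realType) V
    & CompleteNormedModule R V := {
  inner : {dot V for @idfun R} ;
  norm_inner : forall x : V, `|x| = Num.sqrt (inner x x)
}.

#[short(type="hilbertType")]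
HB.structure Definition Hilbert (R : realType) :=
  {V of CompleteNormedModule R V & CompleteNormedModule_isHilbert R V}.

Notation "''[' u , v ]" := (inner u v) : ring_scope.

Section InnerTheory.
Context {R : realType} {H : hilbertType R}.
Implicit Types (x y : H).

Lemma innerC x y : '[x, y] = '[y, x].
Proof. by rewrite (@hermC R false idfun H inner) expr0 mul1r. Qed.

Lemma inner_ge0 x : 0 <= '[x, x].
Proof.
have [->|x0] := eqVneq x 0; first by rewrite linear0r.
exact/ltW/(@neq0_dnorm_gt0 _ _ _ inner).
Qed.

Lemma inner_sqr_norm x : '[x, x] = `|x| ^+ 2.
Proof. by rewrite norm_inner sqr_sqrtr// inner_ge0. Qed.

End InnerTheory.

(* An alias is needed: the library norms H1 * H2 by the maximum of the norms
   of the components, which is not induced by an inner product. *)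
Definition hprod (R : realType) (H1 H2 : hilbertType R) : Type := (H1 * H2)%type.

Section HilbertProduct.
Context {R : realType} {H1 H2 : hilbertType R}.
Local Notation H := (hprod H1 H2).
Implicit Types (z w : H).

HB.instance Definition _ := GRing.Lmodule.copy H (H1 * H2)%type.

Definition hprod_inner z w : R := '[z.1, w.1] + '[z.2, w.2].

Fact hprod_inner_bilinear : bilinear_for *%R (idfun \; *%R) hprod_inner.
Proof.
split=> [w a z1 z2|z a w1 w2]; rewrite /hprod_inner/=.
  by rewrite !linearPl/= mulrDr addrACA.
by rewrite !linearPr/= mulrDr addrACA.
Qed.

HB.instance Definition _ :=
  bilinear_isBilinear.Build R H H R *%R (idfun \; *%R) hprod_inner
    hprod_inner_bilinear.

Fact hprod_inner_hermitian z w :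
  hprod_inner z w = (-1) ^+ false * idfun (hprod_inner w z).
Proof. by rewrite expr0 mul1r/= /hprod_inner innerC [X in _ + X]innerC. Qed.

HB.instance Definition _ :=
  isHermitianSesquilinear.Build R H false idfun hprod_inner
    hprod_inner_hermitian.

Lemma hprod_inner_sqr z : hprod_inner z z = `|z.1| ^+ 2 + `|z.2| ^+ 2.
Proof. by rewrite /hprod_inner !inner_sqr_norm. Qed.

Fact hprod_inner_gt0 z : z != 0 -> 0 < hprod_inner z z.
Proof.
move=> z0; rewrite hprod_inner_sqr lt_neqAle addr_ge0 ?sqr_ge0// andbT eq_sym.
rewrite paddr_eq0 ?sqr_ge0// !sqrf_eq0 !normr_eq0.
by apply: contra z0 => /andP[/eqP z1 /eqP z2]; case: z z1 z2 => ? ? /= -> ->.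
Qed.

HB.instance Definition _ := isDotProduct.Build R H hprod_inner hprod_inner_gt0.

Definition hprod_norm z : R := Num.sqrt (hprod_inner z z).

Lemma hprod_normE z : hprod_norm z = Num.sqrt (`|z.1| ^+ 2 + `|z.2| ^+ 2).
Proof. by rewrite /hprod_norm hprod_inner_sqr. Qed.

Fact ler_hprod_normD z w : hprod_norm (z + w) <= hprod_norm z + hprod_norm w.
Proof.
rewrite !hprod_normE.
have key (a b c d e f : R) : 0 <= a -> 0 <= b -> 0 <= c -> 0 <= d ->
    0 <= e -> 0 <= f -> e <= a + c -> f <= b + d ->
    Num.sqrt (e ^+ 2 + f ^+ 2) <=
    Num.sqrt (a ^+ 2 + b ^+ 2) + Num.sqrt (c ^+ 2 + d ^+ 2).
  move=> a0 b0 c0 d0 e0 f0 eac fbd.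
  have p0 := sqrtr_ge0 (a ^+ 2 + b ^+ 2); have q0 := sqrtr_ge0 (c ^+ 2 + d ^+ 2).
  have pE : Num.sqrt (a ^+ 2 + b ^+ 2) ^+ 2 = a ^+ 2 + b ^+ 2.
    by rewrite sqr_sqrtr// addr_ge0 ?sqr_ge0.
  have qE : Num.sqrt (c ^+ 2 + d ^+ 2) ^+ 2 = c ^+ 2 + d ^+ 2.
    by rewrite sqr_sqrtr// addr_ge0 ?sqr_ge0.
  move: p0 q0 pE qE; set p := Num.sqrt _; set q := Num.sqrt _ => p0 q0 pE qE.
  have acbd : a * c + b * d <= p * q.
    rewrite -ler_sqr ?nnegrE ?addr_ge0 ?mulr_ge0// exprMn pE qE.
    by have := sqr_ge0 (a * d - b * c); nra.
  rewrite -[leRHS]ger0_norm ?addr_ge0// -sqrtr_sqr.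
  have ee : e ^+ 2 <= (a + c) ^+ 2 by rewrite ler_sqr ?nnegrE ?addr_ge0.
  have ff : f ^+ 2 <= (b + d) ^+ 2 by rewrite ler_sqr ?nnegrE ?addr_ge0.
  by rewrite ler_wsqrtr//; nra.
by apply: key; rewrite ?normr_ge0//; exact: ler_normD.
Qed.

Fact hprod_normZ (a : R) z : hprod_norm (a *: z) = `|a| * hprod_norm z.
Proof.
rewrite !hprod_normE/= !normrZ !exprMn -mulrDr sqrtrM ?sqr_ge0//.
by rewrite sqrtr_sqr normr_id.
Qed.

Fact hprod_norm0_eq0 z : hprod_norm z = 0 -> z = 0.
Proof.
move=> z0; apply/eqP; apply: contraT => /hprod_inner_gt0.
by rewrite -sqrtr_gt0 -/(hprod_norm z) z0 ltxx.
Qed.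

HB.instance Definition _ := Lmodule_isNormed.Build R H
  ler_hprod_normD hprod_normZ hprod_norm0_eq0.

Lemma hprod_normrE z : `|z| = Num.sqrt (hprod_inner z z).
Proof. by []. Qed.

Lemma ler_norm_fst z : `|z.1| <= `|z|.
Proof.
rewrite hprod_normrE hprod_inner_sqr -[leLHS]normr_id -sqrtr_sqr.
by rewrite ler_wsqrtr// lerDl sqr_ge0.
Qed.

Lemma ler_norm_snd z : `|z.2| <= `|z|.
Proof.
rewrite hprod_normrE hprod_inner_sqr -[leLHS]normr_id -sqrtr_sqr.
by rewrite ler_wsqrtr// lerDr sqr_ge0.
Qed.

Lemma hprod_norm_le z : `|z| <= `|z.1| + `|z.2|.
Proof.
rewrite -[leRHS]ger0_norm ?addr_ge0// -sqrtr_sqr.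
rewrite hprod_normrE hprod_inner_sqr ler_wsqrtr//.
by have := mulr_ge0 (normr_ge0 z.1) (normr_ge0 z.2); nra.
Qed.

Fact hprod_complete (F : set_system H) : ProperFilter F -> cauchy F -> cvg F.
Proof.
move=> FF /cauchyP Fc.
have c1 : cvg (@fst H1 H2 @ F).
  apply: cauchy_cvg; apply/cauchyP => e e0; have [z Fz] := Fc _ e0.
  exists z.1; change (\forall w \near F, ball z.1 e w.1).
  apply: filterS Fz => w.
  by rewrite -!ball_normE/=; apply: le_lt_trans; exact: (ler_norm_fst (z - w)).
have c2 : cvg (@snd H1 H2 @ F).
  apply: cauchy_cvg; apply/cauchyP => e e0; have [z Fz] := Fc _ e0.
  exists z.2; change (\forall w \near F, ball z.2 e w.2).
  apply: filterS Fz => w.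
  by rewrite -!ball_normE/=; apply: le_lt_trans; exact: (ler_norm_snd (z - w)).
apply/cvg_ex; exists ((lim (@fst H1 H2 @ F), lim (@snd H1 H2 @ F)) : H).
apply/cvgrPdist_lt => e e0.
have e20 : 0 < e / 2 by rewrite divr_gt0.
move/cvgrPdist_lt : c1 => /(_ _ e20) c1; move/cvgrPdist_lt : c2 => /(_ _ e20) c2.
near=> w; apply: le_lt_trans (hprod_norm_le _) _; rewrite [e]splitr ltrD//=.
  by near: w.
by near: w.
Unshelve. all: by end_near. Qed.

HB.instance Definition _ := Uniform_isComplete.Build H hprod_complete.

HB.instance Definition _ :=
  CompleteNormedModule_isHilbert.Build R H (fun z => erefl).

End HilbertProduct.

Lemma hprod_innerE (R : realType) (H1 H2 : hilbertType R) (z w : hprod H1 H2) :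
  '[z, w] = '[z.1, w.1] + '[z.2, w.2].
Proof. by []. Qed.

(* Main.v *)
Require Import Defs.
From mathcomp Require Import all_boot all_order all_algebra.
From mathcomp Require Import all_classical all_reals all_analysis.

Set Implicit Arguments.
Unset Strict Implicit.
Unset Printing Implicit Defensive.

Import Order.TTheory GRing.Theory Num.Theory.
Import numFieldNormedType.Exports.

Local Open Scope classical_set_scope.
Local Open Scope ring_scope.

(** The inner product of [hprod H1 H2] is the sum of those of the components, and [D] is a full
    product, so the two coordinates of a test point vary independently. Freezing one coordinate at
    its solution value kills its term and leaves the inequality on the other factor; conversely, the
    two inequalities add up. The coupling through [A] sits entirely in the membership in [V]. *)

Theorem lemma5p1 (R : realType) (H1 H2 : hilbertType R)
    (f : H1 -> H1) (g : H2 -> H2)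
    (A : {linear H1 -> H2})
    (A_bounded : exists M : R, forall x : H1, `|A x| <= M * `|x|)
    (C : set H1) (Q : set H2)
    (C_nonempty : C !=set0) (C_closed : closed C) (C_convex : convex_set C)
    (Q_nonempty : Q !=set0) (Q_closed : closed Q) (Q_convex : convex_set Q) :
  let D : set (hprod H1 H2) := C `*` Q in
  let V : set (hprod H1 H2) := [set z : hprod H1 H2 | A z.1 = z.2] in
  let h : hprod H1 H2 -> hprod H1 H2 := fun z => (f z.1, g z.2) in
  forall (xs : H1) (ys : H2),
    let zs : hprod H1 H2 := (xs, ys) in
    (zs \in D `&` V /\ (forall z, z \in D -> 0 <= '[h zs, z - zs]))
    <->
    ((xs \in C /\ (forall x, x \in C -> 0 <= '[f xs, x - xs])) /\
     (ys = A xs /\ ys \in Q /\ (forall y, y \in Q -> 0 <= '[g ys, y - ys]))).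
Proof.
move=> D V h xs ys zs; split.
  move=> [/set_mem[[/= xsC ysQ] Axs] zsP].
  split; split=> //; first exact/mem_set.
  - move=> x /set_mem xC.
    (* The test point keeps [ys], admissible since [ys] lies in [Q], so the second term pairs [g ys]
       with 0. *)
    have := zsP (x, ys) (mem_set (conj xC ysQ)).
    by rewrite hprod_innerE/= subrr linear0r addr0.
  - split=> [|y /set_mem yQ]; first exact/mem_set.
    (* Symmetrically, keeping [xs] in [C] cancels the [f] term. *)
    have := zsP (xs, y) (mem_set (conj xsC yQ)).
    by rewrite hprod_innerE/= subrr linear0r add0r.
move=> [[/set_mem xsC xsP] [ysE [/set_mem ysQ ysP]]]; split.
  by apply/mem_set; split; [split|exact: esym].
move=> z /set_mem[zC zQ]; rewrite hprod_innerE.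
by apply: addr_ge0; [apply: xsP|apply: ysP]; exact/mem_set.
Qed.
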